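(* Consider a 0-1 knapsack instance with capacity $c$ and $n$ items with weights $w_1 \ge w_2 \ge \cdots \ge w_n$ (all parameters strictly positive integers, $\sum_{i=1}^n w_i > c$, and $w_i \le c$ for all $i$). Let $g\ge 2$ and integers $0=m_0<m_1<m_2<\cdots<m_g=n$ define the partition of $\{1,\ldots,n\}$ into the $g$ groups $\{m_{i-1}+1,\ldots,m_i\}$, $1\le i\le g$, and let $s_i=m_i-m_{i-1}$. Let $\mathbf{x}=(x_1,\ldots,x_n)$ be an inclusionwise maximal solution and let $l_i=\sum_{j=m_{i-1}+1}^{m_i} x_j$ for $1\le i\le g$. Define $$M=\max\Big\{\sum_{i=1}^{g-1} w_{m_{i-1}+1}\, n_i \;:\; n_i\in\mathbb{Z},\ 0\le n_i\le s_i,\ \sum_{i=1}^{g-1} w_{m_i} n_i\le c\Big\},$$ and let $$z=\min\Big\{a\in\{0,1,\ldots,s_g\} : \sum_{i=m_{g-1}+1}^{m_{g-1}+a} w_i > c - M - w_{m_{g-1}+1}\Big\},$$ with $z=s_g$ if this set is empty. Then $l_g\ge z$.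
   Context: A solution is a vector $\mathbf{x}\in\{0,1\}^n$. A solution $\mathbf{x}$ is inclusionwise maximal if $\sum_{i=1}^n w_i x_i \le c$ and there is no index $j$ with $x_j=0$ and $w_j+\sum_{i=1}^n w_i x_i \le c$. An empty sum equals $0$. *)

(* Defs.v *)
(* Items, groups and vector entries are numbered from 0: item j below is item
   j+1 of the usual 1-based numbering, and group i consists of the items
   m i, ..., (m i.+1).-1.  So the first (heaviest) item of group i is m i, its
   last (lightest) item is (m i.+1).-1, and the g-th group is group g.-1. *)
From mathcomp Require Import all_boot all_order all_algebra.
Set Implicit Arguments.
Unset Strict Implicit.
Unset Printing Implicit Defensive.

Section Knapsack.

Variables (n c : nat) (w : n.-tuple nat).

Definition total_weight (x : n.-tuple bool) : nat :=
  \sum_(i < n) tnth w i * tnth x i.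

Definition inclusionwise_maximal (x : n.-tuple bool) : Prop :=
  total_weight x <= c /\
  ~ (exists j : 'I_n, tnth x j = false /\ tnth w j + total_weight x <= c).

Variables (g : nat) (m : nat -> nat).

Definition group_partition : Prop :=
  [/\ m 0 = 0, m g = n & forall i, i < g -> m i < m i.+1].

Definition group_size (i : nat) : nat := m i.+1 - m i.

Definition group_count (x : n.-tuple bool) (i : nat) : nat :=
  \sum_(m i <= j < m i.+1) nth false x j.

(* The index set is nonempty (all k i = 0 is admissible), so the value 0 that
   \max takes on an empty range plays no role. *)
Definition max_weight : nat :=
  \max_(k : {dffun forall i : 'I_g.-1, 'I_(group_size i).+1}
         | \sum_(i < g.-1) nth 0 w (m i.+1).-1 * k i <= c)
    \sum_(i < g.-1) nth 0 w (m i) * k i.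

(* The right-hand side c - M - w may be negative, hence the comparison in int.
   As a <= group_size g.-1 throughout, using that size as the neutral element
   of minn gives the minimum, and the size itself if no a qualifies. *)
Definition min_count : nat :=
  \big[minn/group_size g.-1]_(a < (group_size g.-1).+1
     | (c%:Z - max_weight%:Z - (nth 0%N w (m g.-1))%:Z
        < (\sum_(m g.-1 <= i < m g.-1 + a) nth 0 w i)%N%:Z)%R) a.

End Knapsack.

(* Main.v *)
(* If l_g < s_g, some item j of the last group is left out of x, so maximality
   gives w_j + w(x) > c.  The groups before the last contribute at most M to
   w(x), because their counts l_i are admissible in the definition of M, and the
   last group contributes at most its l_g heaviest weights.  Hence a = l_g
   qualifies in the minimum that defines z. *)
Require Import Defs.
From mathcomp Require Import all_boot all_order all_algebra zify.

(** The default [s] is arbitrary, not neutral for [minn], so the bound is obtained by induction on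
    the enumeration of [I]. *)
Lemma bigminn_le_cond (I : finType) (P : pred I) (F : I -> nat) (s : nat)
    (i0 : I) :
  P i0 -> \big[minn/s]_(i | P i) F i <= F i0.
Proof.
move=> Pi0; have : i0 \in index_enum I by rewrite mem_index_enum.
elim: (index_enum I) => //= i r IHr; rewrite inE big_cons => /orP[/eqP <-|/IHr le_r].
  by rewrite Pi0 geq_minl.
by case: ifP => // _; rewrite geq_min le_r orbT.
Qed.


(** The inequality is carried through the induction because cutting the range at [m k] requires
    it. *)
Lemma big_nat_group (F : nat -> nat) (m : nat -> nat) (k : nat) :
  (forall i, i < k -> m i <= m i.+1) ->
  m 0 <= m k /\
  \sum_(m 0 <= j < m k) F j = \sum_(i < k) \sum_(m i <= j < m i.+1) F j.
Proof.
elim: k => [|k IHk] m_incr; first by rewrite big_ord0 big_geq.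
have [le0k eqk] := IHk (fun i lt_ik => m_incr i (ltnW lt_ik)).
have lek := m_incr k (leqnn _).
by rewrite (leq_trans le0k lek) (big_cat_nat le0k lek) /= eqk big_ord_recr.
Qed.

Lemma sum_nat_bool_le (X : nat -> bool) (a b : nat) :
  \sum_(a <= j < b) X j <= b - a.
Proof.
rewrite -[b - a]muln1 -sum_nat_const_nat; apply: leq_sum => j _.
exact: leq_b1.
Qed.

Lemma sum_nat_bool_lt (X : nat -> bool) (a b : nat) :
  \sum_(a <= j < b) X j < b - a -> exists2 j, a <= j < b & X j = false.
Proof.
move=> lt_sum; have [/hasP[j]|/hasPn allX] :=
  boolP (has (fun j => ~~ X j) (index_iota a b)).
  by rewrite mem_index_iota => j_ab /negbTE Xj; exists j.
move: lt_sum; rewrite (eq_big_nat _ _ (F2 := fun=> 1)) => [|j j_ab].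
  by rewrite sum_nat_const_nat muln1 ltnn.
by have /allX/negbNE -> : j \in index_iota a b by rewrite mem_index_iota.
Qed.

(** Induction on [s]: if [l] of the first [s] positions are selected and position [a + s] is
    selected too, its weight is at most [W (a + l)], the next term of the prefix, because
    [l <= s]. *)
Lemma selection_le_prefix (W : nat -> nat) (X : nat -> bool) (a s : nat) :
  (forall i j, i <= j -> W j <= W i) ->
  \sum_(a <= j < a + s) W j * X j
    <= \sum_(a <= j < a + \sum_(a <= j < a + s) X j) W j.
Proof.
move=> W_noninc; elim: s => [|s IHs]; first by rewrite addn0 big_geq.
rewrite addnS !big_nat_recr ?leq_addr //=.
have := sum_nat_bool_le X a (a + s); rewrite addKn.
move: (\sum_(a <= j < a + s) X j) IHs => l IHs le_ls.
case: (X _); rewrite ?muln1 ?muln0 ?addn0 //.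
rewrite addn1 addnS big_nat_recr ?leq_addr //=.
by rewrite leq_add // W_noninc // leq_add2l.
Qed.

(** The lower bound serves the capacity constraint in the definition of M, the upper bound its
    objective. *)
Lemma group_weight_bounds (W : nat -> nat) (X : nat -> bool) (a b : nat) :
  (forall i j, i <= j -> W j <= W i) ->
  W b.-1 * \sum_(a <= j < b) X j <= \sum_(a <= j < b) W j * X j
    <= W a * \sum_(a <= j < b) X j.
Proof.
move=> W_noninc; rewrite !big_distrr /=; apply/andP; split;
  rewrite big_nat [leqRHS]big_nat; apply: leq_sum => j j_ab;
  rewrite leq_mul2r W_noninc ?orbT //; lia.
Qed.

Lemma nth_sorted_noninc (n : nat) (w : n.-tuple nat) :
  (forall i j : 'I_n, i <= j -> tnth w j <= tnth w i) ->
  forall i j, i <= j -> nth 0 w j <= nth 0 w i.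
Proof.
(* Past the end, [nth] yields 0, which lies below every weight, so monotonicity extends to all
   indices. *)
move=> w_sorted i j le_ij; have [lt_jn|le_nj] := ltnP j n; last first.
  by rewrite nth_default // size_tuple.
have := w_sorted (Ordinal (leq_ltn_trans le_ij lt_jn)) (Ordinal lt_jn) le_ij.
by rewrite !(tnth_nth 0).
Qed.

Lemma total_weight_nat (n : nat) (w : n.-tuple nat) (x : n.-tuple bool) :
  total_weight w x = \sum_(0 <= j < n) nth 0 w j * nth false x j.
Proof.
rewrite big_mkord; apply: eq_bigr => i _.
by rewrite (tnth_nth 0) (tnth_nth false).
Qed.

Lemma max_weight_ge (n c : nat) (w : n.-tuple nat) (g : nat) (m : nat -> nat)
    (l : nat -> nat) :
  (forall i, l i <= group_size m i) ->
  \sum_(i < g.-1) nth 0 w (m i.+1).-1 * l i <= c ->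
  \sum_(i < g.-1) nth 0 w (m i) * l i <= max_weight c w g m.
Proof.
move=> l_le sum_le.
pose k : {dffun forall i : 'I_g.-1, 'I_(group_size m i).+1} :=
  [ffun i : 'I_g.-1 => inord (l i) : 'I_(group_size m i).+1].
(* The size bound on [l i] ensures that [inord] does not alter its value. *)
have kE i : k i = l i :> nat by rewrite ffunE inordK // ltnS.
rewrite (eq_bigr (fun i : 'I_g.-1 => nth 0 w (m i) * k i)) => [|i _]; last first.
  by rewrite kE.
apply: (leq_bigmax_cond (F := fun k : {dffun forall i : 'I_g.-1, 'I_(group_size m i).+1} =>
  \sum_(i < g.-1) nth 0 w (m i) * k i)).
by rewrite (eq_bigr (fun i : 'I_g.-1 => nth 0 w (m i.+1).-1 * l i)) // => i _; rewrite kE.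
Qed.

Theorem theorem3 (n c : nat) (w : n.-tuple nat) (g : nat) (m : nat -> nat)
    (x : n.-tuple bool)
    (c_gt0 : 0 < c)
    (w_gt0 : forall i : 'I_n, 0 < tnth w i)
    (w_sorted : forall i j : 'I_n, i <= j -> tnth w j <= tnth w i)
    (w_sum : c < \sum_(i < n) tnth w i)
    (w_le_c : forall i : 'I_n, tnth w i <= c)
    (g_ge2 : 2 <= g)
    (m_partition : group_partition n g m)
    (x_maximal : inclusionwise_maximal c w x) :
  min_count c w g m <= group_count m x g.-1.
Proof.
have W_noninc := nth_sorted_noninc n w w_sorted.
have [m0 mg m_incr] := m_partition.
have [x_le_c x_max] := x_maximal.
have gS : g.-1.+1 = g by lia.
have count_le i : group_count m x i <= group_size m i by apply: sum_nat_bool_le.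
set l := group_count m x g.-1.
have l_ltS : l < (group_size m g.-1).+1 by rewrite ltnS count_le.
have := count_le g.-1; rewrite -/l leq_eqVlt => /orP[/eqP l_eq|l_lt].
  (* The last group is full: the minimum never exceeds its default, the group size. *)
  rewrite l_eq /min_count.
  by elim/big_rec: _ => // a b _ le_b; rewrite geq_min le_b orbT.
apply: (bigminn_le_cond _ _ (fun a => nat_of_ord a) _ (Ordinal l_ltS)) => /=.
have [j /andP[le_mj]] := sum_nat_bool_lt _ _ _ l_lt.
rewrite gS mg => lt_jn xj.
have over_c : c < nth 0 w j + total_weight w x.
  rewrite ltnNge; apply/negP => le_c; apply: x_max; exists (Ordinal lt_jn).
  by rewrite (tnth_nth false) (tnth_nth 0).
(* The definition of z refers to the heaviest item of the last group instead of the omitted item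
   [j]. *)
have wj_le : nth 0 w j <= nth 0 w (m g.-1) by apply: W_noninc.
have totalE : total_weight w x =
    \sum_(i < g.-1) \sum_(m i <= j < m i.+1) nth 0 w j * nth false x j
    + \sum_(m g.-1 <= j < m g) nth 0 w j * nth false x j.
  have [|_] := big_nat_group (fun j => nth 0 w j * nth false x j) m g.-1.+1.
    by move=> i; rewrite gS => /m_incr /ltnW.
  by rewrite big_ord_recr /= gS m0 mg total_weight_nat.
have bounds i := group_weight_bounds (nth 0 w) (nth false x) (m i) (m i.+1) W_noninc.
have first_le : \sum_(i < g.-1) \sum_(m i <= j < m i.+1) nth 0 w j * nth false x j
    <= max_weight c w g m.
  apply: (leq_trans (n := \sum_(i < g.-1) nth 0 w (m i) * group_count m x i)).
    by apply: leq_sum => i _; have /andP[] := bounds i.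
  (* Admissibility of the counts: charging each selected item only the lightest weight of its group
     gives at most the weight of [x], hence at most [c]. *)
  apply: max_weight_ge => //; apply: leq_trans x_le_c.
  rewrite totalE; apply: leq_trans (leq_addr _ _).
  by apply: leq_sum => i _; have /andP[] := bounds i.
have last_le : \sum_(m g.-1 <= j < m g) nth 0 w j * nth false x j
    <= \sum_(m g.-1 <= j < m g.-1 + l) nth 0 w j.
  have := selection_le_prefix (nth 0 w) (nth false x) (m g.-1)
    (group_size m g.-1) W_noninc.
  have mgE : m g.-1 + group_size m g.-1 = m g.
    by rewrite /group_size gS subnKC // -[in leqRHS]gS ltnW // m_incr // gS.
  by rewrite mgE /l /group_count gS.
(* Chaining the bounds gives c < w_j + w(x) <= [nth 0 w (m g.-1)] + M + (weight of the first [l]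
   items of the last group), which rearranges to the comparison in [int]. *)
lia.
Qed.
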